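(* Let $n\ge 2$, $\alpha>0$, and let $\mathbf{c}=(c_1,\dots,c_n)\in\mathbb{R}^n_+$ be a nonnegative vector with $c_1=0$ such that the fractional Hadamard power $P^{\circ\alpha}$ of the generalized Pascal matrix $P$ with generating vector $\mathbf{c}$ is positive definite. Then for every $m\ge 2$, if $\mathcal{A}$ is the $m$th order $n$-dimensional generalized Pascal tensor with generating vector $\mathbf{c}$, the tensor $\mathcal{A}^{\circ\alpha}$ is strongly completely positive, and if $m$ is even then $\mathcal{A}^{\circ\alpha}$ is positive definite.
   Context: For a nonnegative $\mathbf{c}\in\mathbb{R}^n$ and $m\ge 2$, the $m$th order $n$-dimensional generalized Pascal tensor with generating vector $\mathbf{c}$ is $\mathcal{A}=(a_{i_1\dots i_m})$ with $a_{i_1\dots i_m}=\frac{\Gamma(c_{i_1}+\dots+c_{i_m}+1)}{\Gamma(c_{i_1}+1)\cdots\Gamma(c_{i_m}+1)}$; for $m=2$ it is the generalized Pascal matrix. For a nonnegative tensor $\mathcal{A}=(a_{i_1\dots i_m})$ and $\alpha>0$, its fractional Hadamard power is $\mathcal{A}^{\circ\alpha}=(a_{i_1\dots i_m}^{\alpha})$. A symmetric tensor of order $m$, dimension $n$ is strongly completely positive if it equals $\sum_{k=1}^r(\mathbf{u}^{(k)})^m$ for nonnegative vectors $\mathbf{u}^{(k)}\in\mathbb{R}^n$ spanning $\mathbb{R}^n$, where $\mathbf{u}^m$ has entries $u_{i_1}\cdots u_{i_m}$. For even $m$, a symmetric tensor $(b_{i_1\dots i_m})$ is positive definite if $\sum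 b_{i_1\dots i_m}x_{i_1}\cdots x_{i_m}>0$ for all nonzero $\mathbf{x}\in\mathbb{R}^n$. *)

(* Defs.v *)
From HB Require Import structures.
From mathcomp Require Import all_boot all_order all_algebra.
From mathcomp Require Import all_classical all_reals all_analysis.
Set Implicit Arguments. Unset Strict Implicit. Unset Printing Implicit Defensive.
Import Order.TTheory GRing.Theory Num.Theory.
Local Open Scope ring_scope.
Local Open Scope classical_set_scope.

Definition Gamma (R : realType) (s : R) : R :=
  Rintegral (@lebesgue_measure R) `[0%R, +oo[%classic
    (fun t => t `^ (s - 1) * expR (- t)).

Definition tensor (R : realType) (m n : nat) := {ffun 'I_m -> 'I_n} -> R.

Definition pascal_tensor (R : realType) (m n : nat) (c : 'I_n -> R) : tensor R m n :=
  fun i => Gamma (\sum_(k < m) c (i k) + 1) / \prod_(k < m) Gamma (c (i k) + 1).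

Arguments pascal_tensor {R} m {n} c _.

Definition hadamard_pow (R : realType) (m n : nat) (A : tensor R m n) (a : R)
  : tensor R m n := fun i => A i `^ a.

Definition strongly_completely_positive (R : realType) (m n : nat) (A : tensor R m n) :=
  exists (r : nat) (u : 'I_r -> 'I_n -> R),
    (forall k j, 0 <= u k j) /\
    \rank (\matrix_(k < r, j < n) u k j) = n /\
    forall i : {ffun 'I_m -> 'I_n}, A i = \sum_(k < r) \prod_(l < m) u k (i l).

Definition positive_definite (R : realType) (m n : nat) (A : tensor R m n) :=
  forall x : 'I_n -> R, (exists j, x j != 0) ->
    0 < \sum_(i : {ffun 'I_m -> 'I_n}) A i * \prod_(l < m) x (i l).

(* Main.v *)
(* Write [s = c_{i_1} + ... + c_{i_m}]. By Gauss's product formula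
   [ln Gamma (s + 1)] is the limit of
   [ln N! + s ln N - ln (s + 1) - ... - ln (s + N)], and each [- ln (s + k)] is,
   up to a constant, a limit of nonnegative combinations of exponentials
   [expR (- d s)]. A tensor with entries [expR (- d s)] is a nonnegative rank-one
   tensor, and completely positive tensors are stable under sums, Hadamard
   products and, by Caratheodory's theorem and compactness, limits, hence under
   entrywise exponentials. So every positive Hadamard power of
   [Gamma (s + 1)], and of the Pascal tensor, is completely positive. Since
   [c_1 = 0], freezing all but two indices at [1] gives back the Pascal matrix,
   whose positive definiteness forces the vectors of the decomposition to span.
   For even [m] the form is the sum of the [m]th powers of their pairings with
   [x], which do not all vanish. *)
Require Import Defs.
From HB Require Import structures.
From mathcomp Require Import all_boot all_order all_algebra.
From mathcomp Require Import all_classical all_reals all_analysis.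
From mathcomp Require Import measurable_realfun ring lra.
Set Implicit Arguments. Unset Strict Implicit. Unset Printing Implicit Defensive.
Import Order.TTheory GRing.Theory Num.Theory.
Import numFieldNormedType.Exports.
Local Open Scope ring_scope.
Local Open Scope classical_set_scope.

(** * The Gamma function *)

Section Gamma_function.
Context {R : realType}.
Implicit Types (c s t x y : R).
Local Notation mu := (@lebesgue_measure R).
Local Notation halfline := (`[(0 : R), +oo[%classic : set R).

(** * The integrand of Gamma: decay, continuity and integrability *)

Definition gamma_density c t : R := t `^ c * expR (- t).

Lemma gamma_density_ge0 c t : 0 <= gamma_density c t.
Proof. by rewrite mulr_ge0 ?powR_ge0 ?expR_ge0. Qed.

Lemma gamma_density_le c : 0 <= c ->
  exists C, 0 <= C /\ forall t, 0 <= t -> gamma_density c t <= C * expR (- (t / 2)).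
Proof.
move=> c0; have [N cN] : exists N, c <= N%:R.
  by exists (Num.truncn c).+1; apply/ltW/truncnS_gt.
exists (1 + 2 ^+ N.+1 * N.+1`!%:R); split.
  by rewrite addr_ge0// mulr_ge0// exprn_ge0.
move=> t t0.
rewrite /gamma_density.
(* One half of the decay absorbs the power, the other half remains in the bound. *)
have -> : expR (- t) = expR (- (t / 2)) * expR (- (t / 2)).
  by rewrite -expRD; congr expR; lra.
rewrite mulrA ler_wpM2r ?expR_ge0//.
have tN : t `^ c <= 1 + t ^+ N.+1.
  have [t1|/ltW t1] := leP t 1.
    apply: (@le_trans _ _ 1); last by rewrite lerDl exprn_ge0.
    have -> : 1 = 1 `^ c by rewrite powR1.
    by rewrite ge0_ler_powR// nnegrE.
  apply: (@le_trans _ _ (t ^+ N.+1)); last by rewrite lerDr.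
  by rewrite -powR_mulrn// ler_powR// (le_trans cN)// ler_nat.
rewrite expRN ler_pdivrMr ?expR_gt0//.
apply: (le_trans tN).
have h0 : 0 <= t / 2 by lra.
have := expR_ge1Dxn N h0.
set F : R := N.+1`!%:R; have F0 : 0 < F by rewrite ltr0n fact_gt0.
rewrite expr_div_n.
set P := 2 ^+ N.+1; have P0 : 0 < P :> R by rewrite exprn_gt0.
set X := t ^+ N.+1; have X0 : 0 <= X by rewrite exprn_ge0.
set E := expR _ => h.
have E1 : 1 <= E by apply: le_trans h; rewrite lerDl !divr_ge0// ltW.
have XE : X <= P * F * E.
  have -> : X = P * F * (X / P / F) by field; rewrite !gt_eqF.
  rewrite ler_wpM2l ?mulr_ge0 1?ltW//; lra.
by rewrite mulrDl mul1r lerD.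
Qed.

Lemma expRN_half_cvg_pinfty (K : R) : K * expR (- (t / 2)) @[t --> +oo] --> (0 : R).
Proof.
rewrite -[X in _ --> X](mulr0 K); apply: cvgMr.
apply: (@cvg_comp _ _ _ (fun t : R => t / 2) (fun t => expR (- t)) _ (pinfty_nbhs R)).
  exact: gt0_cvgMly.
exact: cvgr_expR.
Qed.

Lemma gamma_density_cvg_pinfty c : 0 <= c -> gamma_density c t @[t --> +oo] --> (0 : R).
Proof.
move=> /gamma_density_le[C [C0 h]].
apply: (@squeeze_cvgr _ _ _ _ (fun=> 0) (fun t => C * expR (- (t / 2)))).
- near=> t; rewrite gamma_density_ge0/= h//.
- exact: cvg_cst.
- exact: expRN_half_cvg_pinfty.
Unshelve. all: by end_near. Qed.

Lemma gamma_density_cvg_at_right0 c : 0 <= c ->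
  gamma_density c t @[t --> 0^'+] --> gamma_density c 0.
Proof.
move=> c0; apply: cvgM; last first.
  apply: cvg_at_right_filter; apply: continuous_comp; first exact: opp_continuous.
  exact: continuous_expR.
(* The convention that zero to the power zero is 1 makes the value at 0 the right limit also for
   [c = 0]. *)
move: c0; rewrite le_eqVlt => /predU1P[<-|c0].
  rewrite powRr0; under eq_cvg do rewrite powRr0; exact: cvg_cst.
by rewrite powR0 ?gt_eqF//; exact: powR_cvg0.
Qed.

Lemma is_derive_gamma_density c t : 0 < t ->
  is_derive t 1 (gamma_density c) (c * gamma_density (c - 1) t - gamma_density c t).
Proof.
move=> t0; rewrite /gamma_density.
have := is_derive1_powR c t0 => ?.
apply: is_derive_eq.
rewrite /GRing.scale/=; ring.
Qed.

Lemma continuous_gamma_density c : 0 <= c ->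
  {within `[0, +oo[%classic, continuous (gamma_density c)}.
Proof.
move=> c0; apply/continuous_within_itvcyP; split; last exact: gamma_density_cvg_at_right0.
move=> t; rewrite in_itv/= andbT => t0.
apply: differentiable_continuous; apply/derivable1_diffP.
by have [] := is_derive_gamma_density c t0.
Qed.

Lemma continuous_expRN_half (K : R) : continuous (fun t => K * expR (- (t / 2))).
Proof.
move=> t; apply: cvgMr; apply: continuous_comp; last exact: continuous_expR.
by apply: cvgN; apply: cvgMl; exact: cvg_id.
Qed.

Lemma is_derive_expRN_half (K t : R) :
  is_derive t 1 (fun t => - 2 * K * expR (- (t / 2))) (K * expR (- (t / 2))).
Proof.
have h : is_derive t 1 (expR \o (fun t => - (2^-1 * t))) (expR (- (2^-1 * t)) * - 2^-1).
  have h1 : is_derive t 1 (fun t => - (2^-1 * t)) (- 2^-1).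
    have := is_deriveN (is_deriveZ 2^-1 (is_derive_id t (1 : R))).
    by rewrite /GRing.scale/= mulr1.
  exact: is_derive1_comp (is_derive_expR _) h1.
rewrite (_ : (fun t => _) = (- 2 * K) \*: (expR \o (fun t => - (2^-1 * t)))).
  by apply: is_derive_eq; rewrite /GRing.scale/= [2^-1 * t]mulrC; field.
by apply/funext => x; rewrite /= [2^-1 * x]mulrC.
Qed.

Lemma integral_expRN_half (K : R) : 0 <= K ->
  (\int[mu]_(t in halfline) (K * expR (- (t / 2)))%:E = (2 * K)%:E)%E.
Proof.
move=> K0; rewrite (@ge0_continuous_FTC2y _ _ (fun t => - 2 * K * expR (- (t / 2))) _ 0).
- rewrite mul0r oppr0 expR0 -EFinB; congr (_%:E); ring.
- by move=> t _; rewrite mulr_ge0 ?expR_ge0.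
- by apply: continuous_subspaceT; exact: continuous_expRN_half.
- exact: expRN_half_cvg_pinfty.
- by move=> t _; have [] := is_derive_expRN_half K t.
- by apply: cvg_at_right_filter; exact: continuous_expRN_half.
- by move=> t _; rewrite derive1E; have [_ ->] := is_derive_expRN_half K t.
Qed.

Lemma integrable_expRN_half (K : R) : 0 <= K ->
  mu.-integrable halfline (fun t => (K * expR (- (t / 2)))%:E).
Proof.
move=> K0; apply/integrableP; split.
  apply/measurable_EFinP; apply: measurable_funTS.
  by apply: continuous_measurable_fun; exact: continuous_expRN_half.
under eq_integral do rewrite gee0_abs ?lee_fin ?mulr_ge0 ?expR_ge0//.
by rewrite integral_expRN_half// ltry.
Qed.

Lemma measurable_gamma_density c : 0 <= c ->
  measurable_fun halfline (gamma_density c).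
Proof.
move=> c0; apply: measurable_funM; apply: measurable_funTS.
  exact: measurable_powR.
by apply: measurableT_comp => //; exact: measurable_expR.
Qed.

Lemma integrable_gamma_density c : 0 <= c ->
  mu.-integrable halfline (EFin \o gamma_density c).
Proof.
move=> c0; have [C [C0 h]] := gamma_density_le c0.
apply: (le_integrable _ _ _ (integrable_expRN_half C0)) => //.
  by apply/measurable_EFinP; exact: measurable_gamma_density.
move=> t; rewrite /= in_itv/= andbT => t0.
rewrite lee_fin !ger0_norm ?gamma_density_ge0 ?mulr_ge0 ?expR_ge0//.
exact: h.
Qed.

Lemma GammaE c : Gamma (c + 1) = \int[mu]_(t in halfline) gamma_density c t.
Proof. by rewrite /Gamma addrK. Qed.

(* The integrand of the integration by parts changes sign, whereas the
   fundamental theorem on a half-line needs a nonnegative one: hence the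
   added dominating exponential. *)
Lemma GammaS c : 0 <= c -> Gamma (c + 2) = (c + 1) * Gamma (c + 1).
Proof.
move=> c0; have c1 : 0 <= c + 1 by rewrite addr_ge0.
have [C [C0 hC]] := gamma_density_le c1.
have -> : c + 2 = (c + 1) + 1 by ring.
rewrite !GammaE.
pose g t := (c + 1) * gamma_density c t.
pose f t := g t - gamma_density (c + 1) t.
pose K t := C * expR (- (t / 2)).
have mI : measurable (halfline : set (measurableTypeR R)) by [].
have iK : mu.-integrable halfline (EFin \o K) by exact: integrable_expRN_half.
have ig : mu.-integrable halfline (EFin \o g).
  have := @integrableZl _ _ _ mu _ mI (c + 1) _ (integrable_gamma_density c0).
  by [].
have ic1 := integrable_gamma_density c1.
have iff : mu.-integrable halfline (EFin \o f).
  exact: (@integrableB _ _ _ mu halfline _ (EFin \o g) (EFin \o gamma_density (c + 1))).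
have fK0 t : 0 <= t -> 0 <= f t + K t.
  move=> t0; have := hC _ t0; rewrite -/(K t) /f /g => h.
  have := mulr_ge0 c1 (gamma_density_ge0 c t); lra.
pose F t := gamma_density (c + 1) t + - 2 * C * expR (- (t / 2)).
have dF t : 0 < t -> is_derive t 1 (gamma_density (c + 1)) (f t).
  by move=> /(is_derive_gamma_density (c + 1)); rewrite addrK.
have dG t : 0 < t -> is_derive t 1 F (f t + K t).
  move=> t0; have := dF _ t0 => h; have := is_derive_expRN_half C t => h'.
  exact: is_deriveD.
have FK : \int[mu]_(t in halfline) (f t + K t) = 0 - F 0.
  apply: (@Rintegral_ge0_continuous_FTC2y _ _ F).
  - exact: fK0.
  - have cK : {within halfline, continuous K}.
      by apply: continuous_subspaceT; exact: continuous_expRN_half.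
    move=> t; apply: cvgD; last exact: cK.
    apply: cvgB; last exact: continuous_gamma_density.
    by apply: cvgMr; exact: continuous_gamma_density.
  - rewrite -[X in _ --> X](addr0 0); apply: cvgD; last exact: expRN_half_cvg_pinfty.
    exact: gamma_density_cvg_pinfty.
  - by move=> t /dG[].
  - apply: cvgD; last by apply: cvg_at_right_filter; exact: continuous_expRN_half.
    exact: gamma_density_cvg_at_right0.
  - by move=> t; rewrite in_itv/= andbT derive1E => /dG[].
rewrite RintegralD// RintegralB// RintegralZl// ?integrable_gamma_density// in FK.
(* The density with exponent [c + 1] vanishes at 0, so [- F 0] is [2 * C], the integral of [K]. The
   two cancel and the integral of [f] is 0, which is the functional equation. *)
move: FK; rewrite /F /gamma_density powR0 ?gt_eqF// ?ltr_wpDl//.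
have -> : \int[mu]_(t in halfline) K t = 2 * C.
  by rewrite /Rintegral integral_expRN_half.
rewrite !mul0r oppr0 expR0 => h; lra.
Qed.

(* Convexity of [expR] between the abscissas [0] and [x]. *)
Lemma ler_expR_chord x s : 0 <= s <= 1 -> expR (s * x) <= 1 + s * (expR x - 1).
Proof.
move=> /andP[s0 s1].
have h1 : expR (s * x) * (1 + (x - s * x)) <= expR x.
  have -> : expR x = expR (s * x) * expR (x - s * x) by rewrite -expRD; congr expR; ring.
  by rewrite ler_wpM2l ?expR_ge0 ?expR_ge1Dx.
have h2 : expR (s * x) * (1 - s * x) <= 1.
  rewrite -[leRHS](expRxMexpNx_1 (s * x)).
  by rewrite ler_wpM2l ?expR_ge0 ?expR_ge1Dx.
have s1' : 0 <= 1 - s by lra.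
(* With weights [s] and [1 - s] the terms linear in [x] on the left cancel, leaving
   [expR (s * x)]. *)
have := ler_wpM2l s0 h1; have := ler_wpM2l s1' h2; lra.
Qed.

(** Concavity of the power: after scaling by [a], this is the chord inequality at the abscissa
    [ln (t / a)]. The point [t = 0], which has no logarithm, is treated apart. *)
Lemma ler_powR_tangent a t s : 0 < a -> 0 <= t -> 0 <= s <= 1 ->
  t `^ s <= a `^ s + s * (a `^ s / a) * (t - a).
Proof.
move=> a0 t0 s01; have /andP[s0 s1] := s01.
have a0' : a != 0 by rewrite gt_eqF.
move: t0; rewrite le_eqVlt => /predU1P[<-|t0].
  have -> : a `^ s + s * (a `^ s / a) * (0 - a) = (1 - s) * a `^ s by field.
  have [->|s0'] := eqVneq s 0; first by rewrite !powRr0; lra.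
  by rewrite powR0// mulr_ge0 ?powR_ge0 ?subr_ge0.
have u0 : 0 < t / a by rewrite divr_gt0.
have := ler_expR_chord (ln (t / a)) s01.
rewrite lnK// -ln_powR lnK ?posrE ?powR_gt0// => h.
have -> : t `^ s = a `^ s * (t / a) `^ s.
  by rewrite -powRM ?ltW//; congr (_ `^ _); field.
have -> : a `^ s + s * (a `^ s / a) * (t - a) = a `^ s * (1 + s * (t / a - 1)) by field.
by rewrite ler_wpM2l ?powR_ge0.
Qed.

(** The tangent at [a] to the convex power of exponent [s - 1], multiplied by [t] so that both sides
    make sense at 0. It follows from [ln u <= u - 1], reversed by the sign of [s - 1]. *)
Lemma ger_powR_tangent a t s : 0 < a -> 0 <= t -> 0 <= s <= 1 ->
  t * (a `^ s / a) + (s - 1) * (a `^ s / a ^+ 2) * (t ^+ 2 - a * t) <= t `^ s.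
Proof.
move=> a0 t0 s01; have /andP[s0 s1] := s01.
have a0' : a != 0 by rewrite gt_eqF.
move: t0; rewrite le_eqVlt => /predU1P[<-|t0].
  by rewrite mul0r mulr0 expr0n/= subr0 mulr0 addr0 powR_ge0.
have u0 : 0 < t / a by rewrite divr_gt0.
have h : 1 + (s - 1) * (t / a - 1) <= (t / a) `^ s / (t / a).
  have -> : (t / a) `^ s / (t / a) = expR ((s - 1) * ln (t / a)).
    by rewrite mulrBl mul1r expRB lnK// /powR (gt_eqF u0).
  apply: le_trans (expR_ge1Dx _).
  rewrite lerD2l; have := expR_ge1Dx (ln (t / a)); rewrite lnK// => h.
  by apply: ler_wnM2l; lra.
have ta0 : 0 <= t * (a `^ s / a) by rewrite mulr_ge0 ?divr_ge0 ?powR_ge0// ltW.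
have -> : t `^ s = t * (a `^ s / a) * ((t / a) `^ s / (t / a)).
  have -> : t `^ s = a `^ s * (t / a) `^ s.
    by rewrite -powRM ?ltW//; congr (_ `^ _); field.
  by field; rewrite a0' gt_eqF.
have -> : t * (a `^ s / a) + (s - 1) * (a `^ s / a ^+ 2) * (t ^+ 2 - a * t) =
    t * (a `^ s / a) * (1 + (s - 1) * (t / a - 1)) by field.
exact: ler_wpM2l.
Qed.

Lemma gamma_density0 t : gamma_density 0 t = expR (- t).
Proof. by rewrite /gamma_density powRr0 mul1r. Qed.

Lemma gamma_densityD c s t : 0 <= t -> 0 <= c -> 0 <= s ->
  gamma_density (c + s) t = t `^ s * gamma_density c t.
Proof.
move=> t0 c0 s0; rewrite /gamma_density mulrA [t `^ s * _]mulrC.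
have [->|/negPf tn0] := eqVneq t 0; last by rewrite powRD ?tn0 ?implybT.
have [->|s0'] := eqVneq s 0; first by rewrite addr0 powRr0 mulr1.
by rewrite [0 `^ s]powR0// mulr0 powR0// gt_eqF// ltr_wpDl// lt_neqAle eq_sym s0'.
Qed.

Lemma Gamma1 : Gamma (1 : R) = 1.
Proof.
rewrite -[1 in LHS]add0r GammaE.
rewrite (@Rintegral_ge0_continuous_FTC2y _ _ (- gamma_density 0) _ 0).
- by rewrite fctE gamma_density0 oppr0 expR0; ring.
- by move=> t _; exact: gamma_density_ge0.
- exact: continuous_gamma_density.
- by rewrite -[X in _ --> X]oppr0; apply: cvgN; exact: gamma_density_cvg_pinfty.
- by move=> t t0; have [] := is_deriveN (is_derive_gamma_density 0 t0).
- by apply: cvgN; exact: gamma_density_cvg_at_right0.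
- move=> t; rewrite in_itv/= andbT derive1E => t0.
  have [_ ->] := is_deriveN (is_derive_gamma_density 0 t0).
  by rewrite mul0r sub0r opprK.
Qed.

Lemma integrable_gamma_densityZ (r : R) c : 0 <= c ->
  mu.-integrable halfline (EFin \o (fun t => r * gamma_density c t)).
Proof.
move=> c0; have mI : measurable (halfline : set (measurableTypeR R)) by [].
exact: (@integrableZl _ _ _ mu _ mI r _ (integrable_gamma_density c0)).
Qed.

Lemma Rintegral_gamma_density2 (A B : R) c d : 0 <= c -> 0 <= d ->
  mu.-integrable halfline (EFin \o (fun t => A * gamma_density c t + B * gamma_density d t)) /\
  \int[mu]_(t in halfline) (A * gamma_density c t + B * gamma_density d t) =
  A * Gamma (c + 1) + B * Gamma (d + 1).
Proof.
move=> c0 d0; have iA := integrable_gamma_densityZ A c0.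
have iB := integrable_gamma_densityZ B d0; split.
  exact: (@integrableD _ _ _ mu halfline _ (EFin \o (fun t => A * gamma_density c t))
    (EFin \o (fun t => B * gamma_density d t))).
rewrite (RintegralD _ iA iB)//.
have mI : measurable (halfline : set (measurableTypeR R)) by [].
rewrite (@RintegralZl _ _ _ mu halfline (gamma_density c) A mI (integrable_gamma_density c0)).
rewrite (@RintegralZl _ _ _ mu halfline (gamma_density d) B mI (integrable_gamma_density d0)).
by rewrite (GammaE c) (GammaE d).
Qed.

(* Integrates the tangent to the concave function [t `^ s] at the mean
   [n + 1] of the density. *)
Lemma Gamma_le_tangent n s : 0 <= s <= 1 ->
  Gamma (n%:R + s + 1) <= (n.+1%:R : R) `^ s * Gamma (n%:R + 1).
Proof.
move=> s01; have /andP[s0 s1] := s01; set a : R := n.+1%:R.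
have a0 : 0 < a by rewrite ltr0n.
have an : a = n%:R + 1 by rewrite /a -natr1.
have n0 : (0 : R) <= n%:R by [].
have n1 : (0 : R) <= n%:R + 1 by rewrite addr_ge0.
pose B := s * (a `^ s / a).
pose A := a `^ s - B * a.
have tangent t : 0 <= t -> t `^ s <= A + B * t.
  by move=> t0; have := ler_powR_tangent a0 t0 s01; rewrite -/B /A; lra.
have [iAB IAB] := Rintegral_gamma_density2 A B n0 n1.
have : Gamma (n%:R + s + 1) <= A * Gamma (n%:R + 1) + B * Gamma (n%:R + 1 + 1).
  rewrite -IAB GammaE; apply: le_Rintegral => //.
    by apply: integrable_gamma_density; rewrite addr_ge0.
  move=> t; rewrite /= in_itv/= andbT => t0.
  rewrite !gamma_densityD// powRr1//.
  have := gamma_density_ge0 n%:R t; set g := gamma_density _ _ => g0.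
  by rewrite mulrA -mulrDl ler_wpM2r//; exact: tangent.
move=> h; apply: (le_trans h); rewrite le_eqVlt; apply/orP; left; apply/eqP.
have -> : n%:R + 1 + 1 = n%:R + 2 :> R by ring.
rewrite GammaS// -an /A /B; field.
by rewrite gt_eqF.
Qed.

(* Integrates [t] times the tangent to the convex function [t `^ (s - 1)] at
   [a = n + 2], where the contribution of the slope cancels. *)
Lemma Gamma_ge_tangent n s : 0 <= s <= 1 ->
  (n.+2%:R : R) `^ s / n.+2%:R * Gamma (n%:R + 2) <= Gamma (n%:R + s + 1).
Proof.
move=> s01; have /andP[s0 s1] := s01; set a : R := n.+2%:R.
have a0 : 0 < a by rewrite ltr0n.
have an : a = n%:R + 1 + 1 by rewrite /a -!natr1.
have n0 : (0 : R) <= n%:R by [].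
have n1 : (0 : R) <= n%:R + 1 by rewrite addr_ge0.
have n2 : (0 : R) <= n%:R + 2 by rewrite addr_ge0.
pose B := (s - 1) * (a `^ s / a ^+ 2).
pose A := a `^ s / a - B * a.
have tangent t : 0 <= t -> A * t + B * t ^+ 2 <= t `^ s.
  move=> t0; apply: le_trans (ger_powR_tangent a0 t0 s01).
  by rewrite -/B /A le_eqVlt; apply/orP; left; apply/eqP; ring.
have [iAB IAB] := Rintegral_gamma_density2 A B n1 n2.
have : A * Gamma (n%:R + 1 + 1) + B * Gamma (n%:R + 2 + 1) <= Gamma (n%:R + s + 1).
  rewrite -IAB GammaE; apply: le_Rintegral => //.
    by apply: integrable_gamma_density; rewrite addr_ge0.
  move=> t; rewrite /= in_itv/= andbT => t0.
  rewrite !gamma_densityD// powRr1// (powR_mulrn 2 t0).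
  have := gamma_density_ge0 n%:R t; set g := gamma_density _ _ => g0.
  rewrite [A * (t * g)]mulrA [B * (t ^+ 2 * g)]mulrA -mulrDl ler_wpM2r//.
  exact: tangent.
move=> h; apply: le_trans h; rewrite le_eqVlt; apply/orP; left; apply/eqP.
have -> : n%:R + 1 + 1 = n%:R + 2 :> R by ring.
have -> : n%:R + 2 + 1 = n%:R + 1 + 2 :> R by ring.
rewrite (GammaS n1) /A /B; set G := Gamma _; set G' := Gamma _.
have -> : G' = G by congr Gamma; ring.
have -> : n%:R + 1 + 1 = a by [].
by field; rewrite gt_eqF.
Qed.

Lemma Gamma_nat n : Gamma (n%:R + 1) = n`!%:R :> R.
Proof.
elim: n => [|n ih]; first by rewrite add0r Gamma1.
have -> : n.+1%:R + 1 = n%:R + 2 :> R by rewrite -natr1; ring.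
by rewrite GammaS// ih factS natrM -natr1.
Qed.

Lemma Gamma_shift n s : 0 <= s ->
  Gamma (n%:R + s + 1) = (\prod_(k < n) (s + k.+1%:R)) * Gamma (s + 1).
Proof.
move=> s0; elim: n => [|n ih]; first by rewrite big_ord0 mul1r add0r.
have -> : n.+1%:R + s + 1 = (n%:R + s) + 2 :> R by rewrite -natr1; ring.
have ns0 : 0 <= n%:R + s by rewrite addr_ge0.
rewrite (GammaS ns0) ih big_ord_recr/= -natr1; ring.
Qed.

(** * Gauss's product formula *)

Definition gauss_product n s : R := n`!%:R * n%:R `^ s / \prod_(k < n) (s + k.+1%:R).

Lemma prod_shift_gt0 n s : 0 <= s -> 0 < \prod_(k < n) (s + k.+1%:R) :> R.
Proof. by move=> s0; apply: prodr_gt0 => k _; rewrite ltr_wpDl// ltr0n. Qed.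

(** On the unit interval the tangent lower bound is already positive; the functional equation
    carries this to larger arguments. *)
Lemma Gamma_gt0 c : 0 <= c -> 0 < Gamma (c + 1) :> R.
Proof.
move=> c0.
have [N] : exists N, c < N%:R by exists (Num.truncn c).+1; exact: truncnS_gt.
elim: N c c0 => [c c0 /(le_lt_trans c0)|N ih c c0 cN]; first by rewrite ltxx.
have [c1|/ltW c1] := leP c 1.
  apply: lt_le_trans (_ : 0 < 2 `^ c / 2 * Gamma (0 + 2)) _.
    by rewrite GammaS// add0r Gamma1 !mulr1 divr_gt0// powR_gt0.
  by have := @Gamma_ge_tangent 0 c; rewrite !add0r c0 c1; exact.
have -> : c + 1 = c - 1 + 2 by ring.
rewrite GammaS ?subr_ge0// mulr_gt0//; first lra.
by apply: ih; [lra|rewrite ltrBlDr natr1].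
Qed.

Lemma cvg_invDn (r : R) : 1 <= r -> (r + n%:R)^-1 @[n --> \oo] --> (0 : R).
Proof.
move=> r1; apply: (@squeeze_cvgr _ _ _ _ (fun=> 0) (@harmonic R)).
- near=> n; have r0 : 0 < r + n%:R by rewrite ltr_wpDr// (lt_le_trans _ r1).
  by rewrite invr_ge0 (ltW r0)/= lef_pV2 ?posrE// -natr1 addrC lerD2r.
- exact: cvg_cst.
- exact: cvg_harmonic.
Unshelve. all: by end_near. Qed.

Lemma cvg_ratioDn (r : R) : 1 <= r -> n%:R / (r + n%:R) @[n --> \oo] --> (1 : R).
Proof.
move=> r1; have -> : (fun n => n%:R / (r + n%:R)) = (fun n => 1 - r * (r + n%:R)^-1).
  apply/funext => n; field.
  by rewrite gt_eqF// ltr_wpDr// (lt_le_trans _ r1).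
rewrite -[X in _ --> X]subr0 -[X in _ - X](mulr0 r).
by apply: cvgB; [exact: cvg_cst|apply: cvgMr; exact: cvg_invDn].
Qed.

(** By [Gamma_shift] the ratio of the product to [Gamma (s + 1)] is [n! n^s / Gamma (n + s + 1)].
    The two tangent bounds enclose it between [n / (1 + n)] and [1 + 1 / (1 + n)]. *)
Lemma cvg_gauss_product_unit s : 0 <= s <= 1 -> gauss_product n s @[n --> \oo] --> Gamma (s + 1).
Proof.
move=> s01; have /andP[s0 s1] := s01.
have G0 := Gamma_gt0 s0.
have Gn n : gauss_product n s = n`!%:R * n%:R `^ s * Gamma (s + 1) / Gamma (n%:R + s + 1).
  rewrite Gamma_shift// /gauss_product; field.
  by rewrite !gt_eqF// prod_shift_gt0.
apply: (@squeeze_cvgr _ _ _ _ (fun n => Gamma (s + 1) * (n%:R / (1 + n%:R)))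
  (fun n => Gamma (s + 1) * (1 + (1 + n%:R)^-1))).
- near=> n; have n0 : (0 < n)%N by near: n; exact: nbhs_infty_gt.
  have nR : 0 < n%:R :> R by rewrite ltr0n.
  have n1R : 0 < 1 + n%:R :> R by rewrite addr_gt0.
  have n2R : 0 < n.+2%:R :> R by rewrite ltr0n.
  have F0 : 0 < n`!%:R :> R by rewrite ltr0n fact_gt0.
  have Gp : 0 < Gamma (n%:R + s + 1) by rewrite Gamma_gt0// addr_ge0.
  rewrite Gn; apply/andP; split.
    rewrite (ler_pdivlMr _ _ Gp).
    apply: (@le_trans _ _ (Gamma (s + 1) * (n%:R / (1 + n%:R)) * ((n.+1%:R : R) `^ s * n`!%:R))).
      have K0 : 0 <= Gamma (s + 1) * (n%:R / (1 + n%:R)) by rewrite ltW// (mulr_gt0 G0)// divr_gt0.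
      apply: (ler_wpM2l K0); rewrite -(Gamma_nat n).
      exact: Gamma_le_tangent.
    rewrite [leRHS]mulrC mulrA -!mulrA ler_pM2l// !mulrA [leRHS]mulrC ler_pM2r//.
    have -> : n%:R `^ s = (n%:R / n.+1%:R) `^ s * n.+1%:R `^ s :> R.
      rewrite -powRM ?divr_ge0//; congr (_ `^ _); field.
      by rewrite gt_eqF//; lra.
    rewrite ler_wpM2r ?powR_ge0// -[n.+1%:R]natr1 [_ + 1]addrC ger1_powR// divr_gt0//=.
    by rewrite ler_pdivrMr// mul1r lerDr.
  rewrite (ler_pdivrMr _ _ Gp).
  apply: (@le_trans _ _ (Gamma (s + 1) * (1 + (1 + n%:R)^-1) *
      ((n.+2%:R : R) `^ s / n.+2%:R * Gamma (n%:R + 2)))); last first.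
    have K0 : 0 <= Gamma (s + 1) * (1 + (1 + n%:R)^-1).
      by rewrite ltW// (mulr_gt0 G0)// addr_gt0// invr_gt0.
    by apply: (ler_wpM2l K0); exact: Gamma_ge_tangent.
  rewrite (GammaS (ltW nR)) Gamma_nat.
  have -> : Gamma (s + 1) * (1 + (1 + n%:R)^-1) *
      (n.+2%:R `^ s / n.+2%:R * ((n%:R + 1) * n`!%:R)) = n`!%:R * n.+2%:R `^ s * Gamma (s + 1).
    have e : n.+2%:R = 1 + (1 + n%:R) :> R by rewrite -!natr1; ring.
    rewrite e; set u := _ `^ s; field.
    by rewrite !gt_eqF//; lra.
  rewrite (ler_pM2r G0) (ler_pM2l F0) ge0_ler_powR// ?nnegrE// ler_nat.
  by rewrite -addn2 leq_addr.
- rewrite -[X in _ --> X]mulr1; apply: cvgMr; exact: cvg_ratioDn.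
- rewrite -[X in _ --> X]mulr1; apply: cvgMr; rewrite -[X in _ --> X]addr0.
  by apply: cvgD; [exact: cvg_cst|exact: cvg_invDn].
Unshelve. all: by end_near. Qed.

Lemma gauss_productS n s : 0 <= s ->
  gauss_product n (s + 1) = gauss_product n s * (s + 1) * (n%:R / (s + 1 + n%:R)).
Proof.
move=> s0; rewrite /gauss_product.
have P0 := prod_shift_gt0 n s0.
have s10 : 0 <= s + 1 by rewrite addr_ge0.
have s1 : 0 < s + 1 by rewrite ltr_wpDl.
have P1 := prod_shift_gt0 n s10.
have e : (s + 1) * \prod_(k < n) (s + 1 + k.+1%:R) = \prod_(k < n) (s + k.+1%:R) * (s + 1 + n%:R).
  have -> : s + 1 + n%:R = s + n.+1%:R by rewrite -natr1; ring.
  rewrite -(big_ord_recr n (fun k => s + k.+1%:R))/= big_ord_recl/=; congr (_ * _).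
  by apply: eq_bigr => k _; rewrite /bump/= -[in RHS]natr1 -addrA [1 + _]addrC addrA.
have [->|n0] := eqVneq n 0%N.
  by rewrite powR0 ?gt_eqF// !(mulr0, mul0r).
rewrite powRD ?pnatr_eq0 ?n0 ?implybT// powRr1//.
have d : 0 < s + 1 + n%:R by rewrite ltr_wpDr.
have -> : \prod_(k < n) (s + 1 + k.+1%:R) = \prod_(k < n) (s + k.+1%:R) * (s + 1 + n%:R) / (s + 1).
  by rewrite -e mulrC mulKf// gt_eqF.
by field; rewrite !gt_eqF.
Qed.

(** Unit steps from the interval of length 1: Gauss's product satisfies the functional equation of
    Gamma up to a factor tending to 1. *)
Lemma cvg_gauss_product s : 0 <= s -> gauss_product n s @[n --> \oo] --> Gamma (s + 1).
Proof.
move=> s0.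
have [N] : exists N, s < N%:R by exists (Num.truncn s).+1; exact: truncnS_gt.
elim: N s s0 => [s s0 /(le_lt_trans s0)|N ih s s0 sN]; first by rewrite ltxx.
have [s1|/ltW s1] := leP s 1; first by apply: cvg_gauss_product_unit; rewrite s0.
have s10 : 0 <= s - 1 by rewrite subr_ge0.
have -> : (fun n => gauss_product n s) =
    (fun n => gauss_product n (s - 1) * (s - 1 + 1) * (n%:R / (s - 1 + 1 + n%:R))).
  by apply/funext => n; rewrite -gauss_productS// subrK.
have -> : s + 1 = s - 1 + 2 by ring.
rewrite (GammaS s10) -[X in _ --> X]mulr1 [_ * Gamma _]mulrC; apply: cvgM.
  by apply: cvgMl; apply: ih => //; rewrite ltrBlDr natr1.
by apply: cvg_ratioDn; rewrite subrK.
Qed.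

End Gamma_function.

(** * Completely positive tensors *)

Section completely_positive.
Context {R : realType} {m n : nat}.
Implicit Types (A B : tensor R m n) (u v : 'I_n -> R).

Definition pure_tensor u : tensor R m n := fun i => \prod_(l < m) u (i l).

(** An arbitrary finite index type lets sums and Hadamard products be indexed by disjoint unions and
    cartesian products. The spanning condition is left out here and recovered at the end. *)
Definition completely_positive A := exists (T : finType) (u : T -> 'I_n -> R),
  (forall t j, 0 <= u t j) /\ forall i, A i = \sum_t pure_tensor (u t) i.

Lemma eq_completely_positive A B : A =1 B -> completely_positive A -> completely_positive B.
Proof. by move=> AB [T [u [u0 h]]]; exists T, u; split=> // i; rewrite -AB h. Qed.

Lemma completely_positive_pure u : (forall j, 0 <= u j) -> completely_positive (pure_tensor u).
Proof.
by move=> u0; exists unit, (fun=> u); split => // i; rewrite (big_pred1 tt)// => -[].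
Qed.

Lemma completely_positiveD A B : completely_positive A -> completely_positive B ->
  completely_positive (fun i => A i + B i).
Proof.
move=> [T [u [u0 hu]]] [S [v [v0 hv]]].
exists (T + S)%type, (fun x => match x with inl t => u t | inr s => v s end).
by split=> [[]//|i]; rewrite big_sumType/= hu hv.
Qed.

Lemma pure_tensorM u v i :
  pure_tensor u i * pure_tensor v i = pure_tensor (fun j => u j * v j) i.
Proof. by rewrite /pure_tensor -big_split. Qed.

Lemma completely_positiveM A B : completely_positive A -> completely_positive B ->
  completely_positive (fun i => A i * B i).
Proof.
move=> [T [u [u0 hu]]] [S [v [v0 hv]]].
exists (T * S)%type, (fun x j => u x.1 j * v x.2 j).
split=> [x j|i]; first by rewrite mulr_ge0.
rewrite hu hv big_distrlr/= pair_bigA/=; apply: eq_bigr => x _.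
exact: pure_tensorM.
Qed.

Lemma completely_positive0 : completely_positive (fun=> 0).
Proof. by exists void, (fun=> fun=> 0); split=> // i; rewrite big_pred0// => -[]. Qed.

Lemma completely_positive1 : completely_positive (fun=> 1).
Proof.
apply: eq_completely_positive (@completely_positive_pure (fun=> 1) _) => // i.
by rewrite /pure_tensor big1.
Qed.

Lemma completely_positiveX A k : completely_positive A ->
  completely_positive (fun i => A i ^+ k).
Proof.
move=> hA; elim: k => [|k ih]; first exact: completely_positive1.
by apply: eq_completely_positive (completely_positiveM hA ih) => i; rewrite exprS.
Qed.

Lemma completely_positive_sum (k : nat) (A : 'I_k -> tensor R m n) :
  (forall x, completely_positive (A x)) -> completely_positive (fun i => \sum_(x < k) A x i).
Proof.
elim: k A => [|k ih] A hA.
  by apply: eq_completely_positive completely_positive0 => i; rewrite big_ord0.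
have := completely_positiveD (hA ord0) (ih (fun x => A (lift ord0 x)) (fun=> hA _)).
by apply: eq_completely_positive => i; rewrite big_ord_recl.
Qed.

Context (m0 : (0 < m)%N).

(** A nonnegative factor is absorbed into the vector through its [m]th root. *)
Lemma pure_tensorZ u c i : 0 <= c ->
  pure_tensor (fun j => c `^ m%:R^-1 * u j) i = c * pure_tensor u i.
Proof.
move=> c0; rewrite /pure_tensor big_split/= prodr_const card_ord.
by rewrite -powR_mulrn ?powR_ge0// -powRrM mulVf ?pnatr_eq0 -?lt0n// powRr1.
Qed.

Lemma completely_positiveZ A c : 0 <= c -> completely_positive A ->
  completely_positive (fun i => c * A i).
Proof.
move=> c0 [T [u [u0 hu]]]; exists T, (fun t j => c `^ m%:R^-1 * u t j).
split=> [t j|i]; first by rewrite mulr_ge0 ?powR_ge0.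
by rewrite hu big_distrr/=; apply: eq_bigr => t _; rewrite pure_tensorZ.
Qed.

Local Notation D := #|{ffun 'I_m -> 'I_n}|.

(* With more summands than dimensions there is a linear relation [lam];
   subtracting [lam / max lam] from the unit coefficients keeps them
   nonnegative and kills the one where the maximum is attained. *)
Lemma caratheodory_step r (u : 'I_r.+1 -> 'I_n -> R) : (D < r.+1)%N ->
  (forall k j, 0 <= u k j) ->
  exists v : 'I_r -> 'I_n -> R, (forall k j, 0 <= v k j) /\
    forall i, \sum_(k < r.+1) pure_tensor (u k) i = \sum_(k < r) pure_tensor (v k) i.
Proof.
move=> Dr u0.
pose M := \matrix_(k < r.+1, j < D) pure_tensor (u k) (enum_val j).
have [lam lamM [k0 lam0]] : exists2 lam : 'rV[R]_r.+1, lam *m M = 0 & exists k, 0 < lam 0 k.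
  have : kermx M != 0.
    by rewrite kermx_eq0 /row_free neq_ltn (leq_ltn_trans (rank_leq_col _) Dr).
  case/rowV0Pn => lam /sub_kermxP lamM /rV0Pn[k lamk].
  (* Up to sign, a nonzero relation has a positive coefficient. *)
  have [lamk0|lamk0] := ltP 0 (lam 0 k); first by exists lam => //; exists k.
  exists (- lam); first by rewrite mulNmx lamM oppr0.
  by exists k; rewrite mxE oppr_gt0 lt_neqAle lamk.
have lamE i : \sum_k lam 0 k * pure_tensor (u k) i = 0.
  have := congr1 (fun N : 'rV_D => N 0 (enum_rank i)) lamM; rewrite !mxE => h.
  rewrite -[RHS]h.
  by apply: eq_bigr => k _; rewrite !mxE enum_rankK.
pose kM := [arg max_(k > k0) lam 0 k]%O.
have lamkM k : lam 0 k <= lam 0 kM by rewrite /kM; case: arg_maxP => // k' _; exact.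
have lM0 : 0 < lam 0 kM by exact: lt_le_trans (lamkM k0).
pose c k := 1 - lam 0 k / lam 0 kM.
have c0 k : 0 <= c k by rewrite subr_ge0 ler_pdivrMr// mul1r.
have ckM : c kM = 0 by rewrite /c divff ?subrr// gt_eqF.
exists (fun k j => c (lift kM k) `^ m%:R^-1 * u (lift kM k) j).
split=> [k j|i]; first by rewrite mulr_ge0 ?powR_ge0.
transitivity (\sum_k c k * pure_tensor (u k) i).
  have -> : \sum_k c k * pure_tensor (u k) i =
      \sum_k pure_tensor (u k) i - (lam 0 kM)^-1 * \sum_k lam 0 k * pure_tensor (u k) i.
    by rewrite mulr_sumr -sumrB; apply: eq_bigr => k _; rewrite /c; ring.
  by rewrite lamE mulr0 subr0.
rewrite (bigD1_ord kM)//= ckM mul0r add0r.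
by apply: eq_bigr => k _; rewrite pure_tensorZ.
Qed.

Lemma caratheodory A : completely_positive A ->
  exists u : 'I_D -> 'I_n -> R, (forall k j, 0 <= u k j) /\
    forall i, A i = \sum_(k < D) pure_tensor (u k) i.
Proof.
move=> [T [u [u0 hu]]].
have [r [v [v0 hv]]] : exists r (v : 'I_(r + D) -> 'I_n -> R), (forall k j, 0 <= v k j) /\
    forall i, A i = \sum_(k < r + D) pure_tensor (v k) i.
  (* Padding with [D] zero vectors gives a length of the form [r + D], from which [r] reduction
     steps lead to exactly [D] summands. *)
  exists #|T|, (fun k j => match fintype.split k with inl k => u (enum_val k) j | inr _ => 0 end).
  split=> [k j|i]; first by case: fintype.split.
  rewrite big_split_ord/= [X in _ + X]big1 ?addr0 => [|k _].
    rewrite hu (reindex (@enum_val T T)); last exact: onW_bij (@enum_val_bij T).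
    by apply: eq_bigr => k _; apply: eq_bigr => l _; rewrite (unsplitK (inl _ k)).
  rewrite /pure_tensor (bigD1 (Ordinal m0))//= (unsplitK (inr _ k)) mul0r //.
elim: r v v0 hv => [|r ih] v v0 hv; first by exists v.
have [|w [w0 vw]] := @caratheodory_step _ v _ v0; first by rewrite ltnS leq_addl.
by apply: (ih w w0) => i; rewrite hv vw.
Qed.

(* A bounded number of summands, each bounded by the diagonal entries, so that
   compactness applies. *)
Lemma completely_positive_closed (A_ : nat -> tensor R m n) A :
  (forall N, completely_positive (A_ N)) ->
  (forall i, A_ N i @[N --> \oo] --> A i) ->
  completely_positive A.
Proof.
move=> cpA cvA.
have [U hU] := choice (fun N => caratheodory (cpA N)).
have [B hB] : exists B : R, forall N k j, U N k j <= B.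
  have hb j : exists b : R, forall N, A_ N [ffun=> j] <= b.
    have : cvg (A_ N [ffun=> j] @[N --> \oo]) by apply/cvg_ex; exists (A [ffun=> j]).
    move=> /cvg_seq_bounded /pinfty_ex_gt0[b _ hb].
    by exists b => N; rewrite (le_trans (ler_norm _))// hb.
  have [b {}hb] := choice hb.
  (* A diagonal entry is a sum of [m]th powers, so each power is at most [b j]. A coordinate above 1
     is at most its own [m]th power; the added 1 covers the others. *)
  exists (1 + \sum_j `|b j|) => N k j.
  apply: (@le_trans _ _ (1 + b j)); last first.
    rewrite lerD2l (bigD1 j)//= (le_trans (ler_norm _))// lerDl.
    by apply: sumr_ge0.
  rewrite leNgt; apply/negP => ub.
  have um : U N k j ^+ m <= b j.
    apply: le_trans (hb j N); rewrite (hU N).2 (bigD1 k)//=.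
    have -> : U N k j ^+ m = pure_tensor (U N k) [ffun=> j].
      rewrite /pure_tensor (eq_bigr (fun=> U N k j)) => [|l _]; last by rewrite ffunE.
      by rewrite prodr_const card_ord.
    rewrite lerDl; apply: sumr_ge0 => k' _.
    by apply: prodr_ge0 => l _; exact: (hU N).1.
  have u1 : 1 <= U N k j.
    rewrite ltW// (le_lt_trans _ ub)// lerDl (le_trans _ um)//.
    by rewrite exprn_ge0// (hU N).1.
  have := ler_eXnr m0 u1; lra.
pose w N : 'rV[R]_(D * n) := mxvec (\matrix_(k, j) U N k j).
pose F (i : {ffun 'I_m -> 'I_n}) (x : 'rV[R]_(D * n)) : R :=
  \sum_(k < D) \prod_(l < m) x 0 (mxvec_index k (i l)).
have Fw i N : F i (w N) = A_ N i.
  rewrite (hU N).2; apply: eq_bigr => k _; apply: eq_bigr => l _.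
  by rewrite mxvecE mxE.
have cF i : continuous (F i).
  apply: continuous_big => [|k _]; first exact: add_continuous.
  apply: continuous_big => [|l _]; first exact: mul_continuous.
  exact: coord_continuous.
pose K := [set x : 'rV[R]_(D * n) | forall j, `[0, B]%classic (x ord0 j)].
have cK : compact K.
  by apply: (@rV_compact R _ (fun=> `[0, B]%classic)) => j; exact: segment_compact.
have wK N : K (w N).
  move=> j; case/mxvec_indexP: j => k j.
  by rewrite mxvecE mxE /= in_itv/= (hU N).1 hB.
(* An ultrafilter finer than the sequence replaces a convergent subsequence: along it [F i] tends
   both to [A i] and to [F i x]. *)
have [G [uG wG]] := ultraFilterLemma (fmap_proper_filter w eventually_filter).
have GK : G K by apply: wG; exists 0%N => // N _; exact: wK.
have [x [Kx Gx]] : exists x, K x /\ G --> x.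
  by move: cK; rewrite compact_ultra => /(_ G uG GK) [x []]; exists x.
have Ax i : A i = F i x.
  apply: (@cvg_unique _ _ (F i @ G)) => //.
    apply: cvg_trans (cvA i); move=> S SA; apply: wG.
    by move: SA; rewrite /nbhs/= => -[N0 _ h]; exists N0 => // N /h; rewrite /= Fw.
  by apply: cvg_trans (cF i x); exact: cvg_app.
exists 'I_D, (fun k j => x 0 (mxvec_index k j)); split => [k j|i]; last by rewrite Ax.
by have := Kx (mxvec_index k j); rewrite /= in_itv/= => /andP[].
Qed.

End completely_positive.

(** * Limits for the logarithm and the exponential *)

Section logarithm.
Context {R : realType}.
Implicit Types x y : R.

Definition log_tail N x : R := - ln (1 - x) - \sum_(k < N) x ^+ k.+1 / k.+1%:R.

(** The derivative of [- ln (1 - x)] is the sum of the geometric series, and each term subtracted in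
    the tail removes one power of [x] from it. *)
Lemma is_derive_log_tail N x : x < 1 -> is_derive x 1 (log_tail N) (x ^+ N / (1 - x)).
Proof.
move=> x1; have x1' : 0 < 1 - x by rewrite subr_gt0.
have dln : is_derive x 1 (fun x => - ln (1 - x)) (1 - x)^-1.
  have h1 : is_derive x 1 (fun x => 1 - x) (- 1).
    have := is_deriveB (is_derive_cst (1 : R) x 1) (is_derive_id x (1 : R)).
    by rewrite sub0r.
  have := is_deriveN (@is_derive1_comp R (@ln R) (fun x => 1 - x) x _ _ (is_derive1_ln x1') h1).
  by rewrite mulrN1 opprK.
elim: N => [|N ih].
  rewrite mul1r (_ : log_tail 0 = fun x => - ln (1 - x))//.
  by apply/funext => z; rewrite /log_tail big_ord0 subr0.
have dX : is_derive x 1 (N.+1%:R^-1 \*: (fun x => x ^+ N.+1)) (x ^+ N).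
  have h : is_derive x 1 (fun x => x ^+ N.+1) (N.+1%:R * x ^+ N).
    have := is_deriveX N.+1 (is_derive_id x (1 : R)).
    by rewrite fctE /GRing.scale/= mulr1.
  apply: (is_derive_eq (is_deriveZ N.+1%:R^-1 h)).
  by rewrite /GRing.scale/= mulKf ?pnatr_eq0.
have -> : log_tail N.+1 = log_tail N - (N.+1%:R^-1 \*: (fun x => x ^+ N.+1)).
  by apply/funext => z; rewrite /log_tail big_ord_recr/= opprD addrA [_ / _]mulrC.
have -> : x ^+ N.+1 / (1 - x) = x ^+ N / (1 - x) - x ^+ N.
  by rewrite exprS; field; rewrite gt_eqF.
exact: is_deriveB.
Qed.

(** The tail vanishes at 0, so the mean value theorem bounds it at [y] by [y ^+ N / (1 - y)], which
    tends to 0. *)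
Lemma cvg_log_series y : 0 <= y < 1 ->
  \sum_(k < N) y ^+ k.+1 / k.+1%:R @[N --> \oo] --> - ln (1 - y).
Proof.
move=> /andP[y0 y1]; have y1' : 0 < 1 - y by rewrite subr_gt0.
have tail N : 0 <= log_tail N y <= y ^+ N / (1 - y).
  have [x||c] := @MVT_segment R (log_tail N) (fun x => x ^+ N / (1 - x)) 0 y y0.
  - by rewrite in_itv/= => /andP[_ xy]; apply: is_derive_log_tail; exact: lt_trans y1.
  - apply: derivable_within_continuous => x; rewrite in_itv/= => /andP[_ xy].
    by have [] := is_derive_log_tail N (le_lt_trans xy y1).
  rewrite in_itv/= => /andP[c0 cy].
  have -> : log_tail N 0 = 0.
    rewrite /log_tail subr0 ln1 oppr0 sub0r big1 ?oppr0// => k _.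
    by rewrite expr0n mul0r.
  rewrite !subr0 => ->.
  have c1 : 0 < 1 - c by rewrite subr_gt0 (le_lt_trans cy).
  have q0 : 0 <= c ^+ N / (1 - c) by rewrite divr_ge0 ?exprn_ge0// ltW.
  rewrite mulr_ge0//=; apply: (@le_trans _ _ (c ^+ N / (1 - c))).
    by rewrite ler_piMr// ltW.
  have cN : c ^+ N <= y ^+ N by rewrite lerXn2r.
  have c1V : (1 - c)^-1 <= (1 - y)^-1 by rewrite lef_pV2// lerD2l lerN2.
  by rewrite ler_pM ?exprn_ge0// invr_ge0 ltW.
have -> : (fun N => \sum_(k < N) y ^+ k.+1 / k.+1%:R) = (fun N => - ln (1 - y) - log_tail N y).
  by apply/funext => N; rewrite /log_tail; ring.
rewrite -[X in _ --> X]subr0; apply: cvgB; first exact: cvg_cst.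
apply: (@squeeze_cvgr _ _ _ _ (fun=> 0) (fun N => y ^+ N / (1 - y))).
- by apply: nearW => N; exact: tail.
- exact: cvg_cst.
- rewrite -[X in _ --> X](mul0r (1 - y)^-1); apply: cvgMl.
  by apply: cvg_expr; rewrite ger0_norm.
Qed.

(** Exhibits [x] as a limit of affine functions of [expR (- d x)]. The inequalities
    [1 - d x <= expR (- d x) <= 1 / (1 + d x)] place the quotient between [x - d x^2] and [x]. *)
Lemma cvg_expR_difference (x : R) : 0 <= x ->
  (1 - expR (- (harmonic N * x))) / harmonic N @[N --> \oo] --> x.
Proof.
move=> x0.
have bounds (d : R) : 0 < d -> x - d * x ^+ 2 <= (1 - expR (- (d * x))) / d <= x.
  move=> d0; have dx0 : 0 <= d * x by rewrite mulr_ge0// ltW.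
  have h1 := expR_ge1Dx (- (d * x)).
  have h2 : expR (- (d * x)) * (1 + d * x) <= 1.
    rewrite -[leRHS](expRxMexpNx_1 (d * x)) mulrC.
    by rewrite ler_wpM2r ?expR_ge0 ?expR_ge1Dx.
  rewrite ler_pdivlMr// ler_pdivrMr//; apply/andP; split; last lra.
  have h3 : d * x * (1 - d * x) <= d * x * expR (- (d * x)).
    by rewrite ler_wpM2l//; lra.
  lra.
apply: (@squeeze_cvgr _ _ _ _ (fun N => x - harmonic N * x ^+ 2) (fun=> x)).
- by apply: nearW => N; apply: bounds; rewrite invr_gt0 ltr0n.
- rewrite -[X in _ --> X]subr0 -[X in _ - X](mul0r (x ^+ 2)).
  by apply: cvgB; [exact: cvg_cst|apply: cvgMl; exact: cvg_harmonic].
- exact: cvg_cst.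
Qed.

Lemma cvg_ln (u : nat -> R) (l : R) : 0 < l -> u N @[N --> \oo] --> l ->
  ln (u N) @[N --> \oo] --> ln l.
Proof.
move=> l0 ul; apply: (@cvg_comp _ _ _ u (@ln R) _ (nbhs l)) => //.
exact: continuous_ln.
Qed.

Lemma ln_prod (T : finType) (f : T -> R) : (forall t, 0 < f t) ->
  ln (\prod_t f t) = \sum_t ln (f t).
Proof.
move=> f0; apply: expR_inj; rewrite lnK ?posrE ?prodr_gt0//.
by rewrite expR_sum; apply: eq_bigr => t _; rewrite lnK// posrE.
Qed.

End logarithm.

(** * Tensors with completely positive Hadamard powers *)

Section infinitely_divisible.
Context {R : realType} {m n : nat} (m0 : (0 < m)%N).
Implicit Types (A B g : tensor R m n).
Local Notation completely_positive := (@completely_positive R m n).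

Lemma completely_positive_expR A : completely_positive A ->
  completely_positive (fun i => expR (A i)).
Proof.
move=> hA.
apply: (completely_positive_closed m0 (A_ := fun N i => \sum_(k < N) k`!%:R^-1 * A i ^+ k)).
  move=> N; apply: completely_positive_sum => k.
  by apply: completely_positiveZ => //; exact: completely_positiveX.
move=> i; have := is_cvg_series_exp_coeff (A i).
rewrite exp_coeffE /series/=; under eq_fun do rewrite big_mkord.
by rewrite expRE /pseries /series/=; under [in X in _ -> _ --> X]eq_fun do rewrite big_mkord.
Qed.

(* Exponents of the tensors all of whose Hadamard powers are completely
   positive. *)
Definition infinitely_divisible g :=
  forall a : R, 0 <= a -> completely_positive (fun i => expR (a * g i)).

Lemma eq_infinitely_divisible g g' : g =1 g' ->
  infinitely_divisible g -> infinitely_divisible g'.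
Proof. by move=> /funext ->. Qed.

Lemma infinitely_divisible_completely_positive A : completely_positive A ->
  infinitely_divisible A.
Proof.
by move=> hA a a0; apply: completely_positive_expR; exact: completely_positiveZ.
Qed.

Lemma infinitely_divisibleD g g' : infinitely_divisible g -> infinitely_divisible g' ->
  infinitely_divisible (fun i => g i + g' i).
Proof.
move=> hg hg' a a0.
apply: eq_completely_positive (completely_positiveM (hg a a0) (hg' a a0)) => i.
by rewrite mulrDr expRD.
Qed.

(** The exponential turns the sum into a single pure tensor, whose vector is positive whatever the
    sign of [h]. In particular constants of either sign are covered. *)
Lemma infinitely_divisible_additive (h : 'I_n -> R) :
  infinitely_divisible (fun i => \sum_(l < m) h (i l)).
Proof.
move=> a a0; apply: eq_completely_positive
    (@completely_positive_pure _ _ _ (fun j => expR (a * h j)) _) => [i|j].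
  by rewrite /pure_tensor -expR_sum mulr_sumr.
exact: expR_ge0.
Qed.

Lemma infinitely_divisible_cst (c : R) : infinitely_divisible (fun=> c).
Proof.
apply: eq_infinitely_divisible (infinitely_divisible_additive (fun=> c / m%:R)) => i.
by rewrite sumr_const card_ord -[_ *+ m]mulr_natr divfK// pnatr_eq0 -lt0n.
Qed.

Lemma infinitely_divisible_sum N (g : 'I_N -> tensor R m n) :
  (forall k, infinitely_divisible (g k)) ->
  infinitely_divisible (fun i => \sum_(k < N) g k i).
Proof.
elim: N g => [|N ih] g hg.
  by apply: eq_infinitely_divisible (infinitely_divisible_cst 0) => i; rewrite big_ord0.
have := infinitely_divisibleD (hg ord0) (ih (fun k => g (lift ord0 k)) (fun=> hg _)).
by apply: eq_infinitely_divisible => i; rewrite big_ord_recl.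
Qed.

Lemma infinitely_divisible_closed (g_ : nat -> tensor R m n) g :
  (forall N, infinitely_divisible (g_ N)) ->
  (forall i, g_ N i @[N --> \oo] --> g i) ->
  infinitely_divisible g.
Proof.
move=> hg cg a a0; apply: (completely_positive_closed m0 (fun N => hg N a a0)) => i.
apply: (@cvg_comp _ _ _ (fun N => a * g_ N i) expR _ (nbhs (a * g i))).
  by apply: cvgMr; exact: cg.
exact: continuous_expR.
Qed.

Lemma infinitely_divisible_ln1B A : completely_positive A ->
  (forall i, 0 <= A i < 1) -> infinitely_divisible (fun i => - ln (1 - A i)).
Proof.
move=> hA A01; apply: (infinitely_divisible_closed
    (g_ := fun N i => \sum_(k < N) A i ^+ k.+1 / k.+1%:R)); last first.
  by move=> i; exact: cvg_log_series.
move=> N; apply: infinitely_divisible_sum => k.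
apply: infinitely_divisible_completely_positive.
apply: eq_completely_positive
  (completely_positiveZ m0 (_ : 0 <= k.+1%:R^-1) (completely_positiveX k.+1 hA)) => [i|].
  by rewrite mulrC.
by rewrite invr_ge0.
Qed.

End infinitely_divisible.

(** * Pascal tensors *)

Section gamma_tensor.
Context {R : realType} {m n : nat} (m0 : (0 < m)%N).
Context (c : 'I_n -> R) (c0 : forall j, 0 <= c j).
Local Notation infinitely_divisible := (@infinitely_divisible R m n).
Let s (i : {ffun 'I_m -> 'I_n}) : R := \sum_(l < m) c (i l).

Let s_ge0 i : 0 <= s i. Proof. exact: sumr_ge0. Qed.

(* With [d] tending to [0], [s + K] is the limit of
   [K + (1 - expR (- d s)) / d = ((1 + K d) / d) (1 - q expR (- d s))],
   where [q = 1 / (1 + K d) < 1], and [- ln (1 - y)] is a power series in [y]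
   with nonnegative coefficients. *)
Lemma infinitely_divisible_ln_shift k :
  infinitely_divisible (fun i => - ln (s i + k.+1%:R)).
Proof.
apply: (infinitely_divisible_closed m0 (g_ := fun N i =>
  - ln (k.+1%:R + (1 - expR (- (harmonic N * s i))) / harmonic N))); last first.
  move=> i; apply: cvgN; apply: cvg_ln; first by rewrite ltr_wpDl// ltr0n.
  rewrite addrC; apply: cvgD; first exact: cvg_cst.
  exact: cvg_expR_difference.
move=> N; set d : R := harmonic N.
have d0 : 0 < d by rewrite invr_gt0 ltr0n.
set K : R := k.+1%:R.
have k0 : 0 < K by rewrite ltr0n.
clearbody K.
have kd0 : 0 < K * d by rewrite mulr_gt0.
pose q := (1 + K * d)^-1.
have qd0 : 0 < 1 + K * d by rewrite addr_gt0.
have q0 : 0 < q by rewrite invr_gt0.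
have q1 : q < 1 by rewrite invf_lt1// ltrDl.
pose A (i : {ffun 'I_m -> 'I_n}) := q * expR (- (d * s i)).
have e1 i : expR (- (d * s i)) <= 1 by rewrite expR_le1 oppr_le0 mulr_ge0// ltW.
have A01 i : 0 <= A i < 1.
  rewrite mulr_ge0 ?expR_ge0 ?ltW//= (le_lt_trans _ q1)// ler_piMr// ltW//.
have cpA : completely_positive A.
  apply: (completely_positiveZ m0 (ltW q0)).
  apply: eq_completely_positive
      (@completely_positive_pure _ _ _ (fun j => expR (- (d * c j))) _) => [i|j].
    by rewrite /pure_tensor -expR_sum sumrN -mulr_sumr.
  exact: expR_ge0.
have := infinitely_divisibleD (infinitely_divisible_cst m0 (- ln ((1 + K * d) / d)))
  (infinitely_divisible_ln1B m0 cpA A01).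
apply: eq_infinitely_divisible => i.
rewrite -opprD -lnM ?posrE ?divr_gt0 ?subr_gt0 ?(andP (A01 i)).2//.
congr (- ln _); rewrite /A /q; field.
by rewrite !gt_eqF.
Qed.

(** In the logarithm of Gauss's product the power of [N] is additive in the indices, the factorial
    is constant, and each denominator is a shifted logarithm treated above. *)
Lemma infinitely_divisible_ln_Gamma :
  infinitely_divisible (fun i => ln (Gamma (s i + 1))).
Proof.
(* Starting at [N.+1] keeps the base of the power positive, as the logarithm identities require. *)
apply: (infinitely_divisible_closed m0
    (g_ := fun N i => ln (gauss_product N.+1 (s i)))); last first.
  move=> i; apply: cvg_ln; first exact: Gamma_gt0.
  have := cvg_gauss_product (s_ge0 i).
  by rewrite -(cvg_shiftS (fun N => gauss_product N (s i))).
move=> N.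
have := infinitely_divisibleD (infinitely_divisible_additive (fun j => c j * ln N.+1%:R))
  (infinitely_divisibleD (infinitely_divisible_cst m0 (ln N.+1`!%:R))
    (infinitely_divisible_sum m0 (fun k : 'I_N.+1 => infinitely_divisible_ln_shift k))).
apply: eq_infinitely_divisible => i.
have F0 : 0 < N.+1`!%:R :> R by rewrite ltr0n fact_gt0.
have N0 : 0 < N.+1%:R `^ s i :> R by rewrite powR_gt0// ltr0n.
have P0 := prod_shift_gt0 N.+1 (s_ge0 i).
rewrite /gauss_product ln_div ?posrE ?mulr_gt0// lnM ?posrE// ln_powR.
rewrite ln_prod => [|k]; last by rewrite ltr_wpDl// ltr0n.
by rewrite -mulr_suml sumrN -/(s i); ring.
Qed.

(** The denominator of the Pascal tensor is a product over the indices, hence contributes an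
    additive term to the logarithm. *)
Lemma completely_positive_pascal (a : R) : 0 <= a ->
  completely_positive (hadamard_pow (pascal_tensor m c) a).
Proof.
move=> a0.
have := infinitely_divisibleD infinitely_divisible_ln_Gamma
  (infinitely_divisible_additive (fun j => - ln (Gamma (c j + 1)))).
move=> /(_ a a0); apply: eq_completely_positive => i.
have G0 : 0 < Gamma (s i + 1) by exact: Gamma_gt0.
have P0 : 0 < \prod_(l < m) Gamma (c (i l) + 1).
  by apply: prodr_gt0 => l _; exact: Gamma_gt0.
rewrite /hadamard_pow /pascal_tensor -/(s i) sumrN -ln_prod => [|l]; last exact: Gamma_gt0.
by rewrite -ln_div// /powR gt_eqF ?divr_gt0.
Qed.

End gamma_tensor.

(** * Spanning vectors and positive definiteness *)

Section spanning.
Context {R : realType} {n : nat}.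

Lemma sum_pure_form m r (u : 'I_r -> 'I_n -> R) (x : 'I_n -> R) :
  \sum_(i : {ffun 'I_m -> 'I_n}) (\sum_(k < r) \prod_(l < m) u k (i l)) * \prod_(l < m) x (i l) =
  \sum_(k < r) (\sum_j u k j * x j) ^+ m.
Proof.
under eq_bigr do rewrite mulr_suml.
rewrite exchange_big/=; apply: eq_bigr => k _.
have -> : (\sum_j u k j * x j) ^+ m = \prod_(l < m) \sum_j u k j * x j.
  by rewrite prodr_const card_ord.
rewrite bigA_distr_bigA/=.
by apply: eq_bigr => i _; rewrite big_split.
Qed.

(** Spanning expressed by orthogonality: full column rank means that the kernel is trivial. *)
Lemma rank_eq_colP r (u : 'I_r -> 'I_n -> R) :
  \rank (\matrix_(k < r, j < n) u k j) = n <->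
  (forall x : 'I_n -> R, (forall k, \sum_j u k j * x j = 0) -> forall j, x j = 0).
Proof.
set M := \matrix_(k, j) _; split=> [rM x ux j|ux].
  have : row_free M^T by rewrite /row_free mxrank_tr rM.
  move=> /row_freeP[N MN].
  have : (\row_j x j) *m M^T = 0.
    apply/rowP => k; rewrite !mxE -[RHS](ux k).
    by apply: eq_bigr => i _; rewrite !mxE mulrC.
  move=> /(congr1 (mulmx^~ N)); rewrite -mulmxA MN mulmx1 mul0mx.
  by move=> /rowP/(_ j); rewrite !mxE.
apply/eqP; rewrite -mxrank_tr; change (row_free M^T); rewrite -kermx_eq0.
apply/eqP/row_matrixP => k; rewrite row0; apply/rowP => j; rewrite [RHS]mxE.
apply: (ux (fun j => row k (kermx M^T) 0 j)) => k'.
have : row k (kermx M^T) *m M^T = 0 by rewrite -row_mul mulmx_ker row0.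
move=> /rowP/(_ k'); rewrite mxE [RHS]mxE => kerM; rewrite -[RHS]kerM.
by apply: eq_bigr => i _; rewrite [M^T _ _]mxE [M _ _]mxE mulrC.
Qed.

(* Padding an index pair with an index of generator 0 identifies the Pascal
   matrix with a slice of the Pascal tensor. *)
Definition pad_index m (o : 'I_n) (i : {ffun 'I_2 -> 'I_n}) : {ffun 'I_m -> 'I_n} :=
  [ffun l : 'I_m => if l == 0%N :> nat then i ord0 else if l == 1%N :> nat then i ord_max else o].

(** Stated for any monoid law so as to serve both the sum inside Gamma and the products. *)
Lemma big_pad_index (idx : R) (op : Monoid.law idx) m o (i : {ffun 'I_2 -> 'I_n}) (f : 'I_n -> R) :
  \big[op/idx]_(l < m.+2) f (pad_index m.+2 o i l) =
  op (\big[op/idx]_(l < 2) f (i l)) (\big[op/idx]_(l < m) f o).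
Proof.
rewrite big_ord_recl/= big_ord_recl/= !ffunE/= big_ord_recl big_ord1.
rewrite (_ : lift ord0 ord0 = ord_max); last exact: val_inj.
rewrite -Monoid.mulmA; congr (op _ (op _ _)).
by apply: eq_bigr => l _; rewrite ffunE.
Qed.

Lemma pascal_pad_index m (c : 'I_n -> R) o i (a : R) : c o = 0 ->
  hadamard_pow (pascal_tensor m.+2 c) a (pad_index m.+2 o i) =
  hadamard_pow (pascal_tensor 2 c) a i.
Proof.
move=> co; rewrite /hadamard_pow /pascal_tensor.
rewrite (big_pad_index _ _ _ _ c) (big_pad_index _ _ _ _ (fun j => Gamma (c j + 1))) /=.
have -> : \sum_(l < m) c o = 0 by rewrite big1.
have -> : \prod_(l < m) Gamma (c o + 1) = 1 by rewrite big1// co add0r Gamma1.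
by rewrite addr0 mulr1.
Qed.

(** On the slice, the form of [B] at [x] is the sum over [k] of [u k o ^+ m] times the squared
    pairing of [u k] with [x]. A nonzero [x] orthogonal to every [u k] would make it vanish. *)
Lemma spanning_of_slice m r (u : 'I_r -> 'I_n -> R) (A : tensor R m.+2 n) (B : tensor R 2 n) o :
  (forall i, A i = \sum_(k < r) \prod_(l < m.+2) u k (i l)) ->
  (forall i, A (pad_index m.+2 o i) = B i) ->
  positive_definite B ->
  \rank (\matrix_(k < r, j < n) u k j) = n.
Proof.
move=> Au AB pB; apply/rank_eq_colP => x ux j; apply/eqP/negPn/negP => xj.
have := pB x (ex_intro _ j xj).
under eq_bigr => i _.
  rewrite -AB Au; under eq_bigr do rewrite (big_pad_index _ _ _ _ (u _))/=.
  rewrite mulr_suml; over.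
rewrite exchange_big/= big1 ?ltxx// => k _.
transitivity (u k o ^+ m * \sum_(i : {ffun 'I_2 -> 'I_n}) \prod_(l < 2) (u k (i l) * x (i l))).
  rewrite mulr_sumr; apply: eq_bigr => i _.
  by rewrite prodr_const card_ord big_split/=; ring.
rewrite -(bigA_distr_bigA (fun _ : 'I_2 => fun j => u k j * x j))/=.
by rewrite big_ord_recl/= ux mul0r mulr0.
Qed.

Lemma positive_definite_of_spanning m (A : tensor R m n) :
  (0 < m)%N -> ~~ odd m -> strongly_completely_positive A -> positive_definite A.
Proof.
move=> m0 em [r [u [u0 [ru Au]]]] x [j xj].
under eq_bigr do rewrite Au.
rewrite sum_pure_form.
have ge0 k : 0 <= (\sum_j u k j * x j) ^+ m by rewrite exprn_even_ge0.
rewrite lt_neqAle sumr_ge0 ?andbT; last by move=> k _; exact: ge0.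
rewrite eq_sym psumr_neq0//; apply/hasP.
have [k uk] : exists k, \sum_j u k j * x j != 0.
  apply: contrapT => nex.
  have ux k : \sum_j u k j * x j = 0 by apply/eqP/negPn/negP => uk; apply: nex; exists k.
  have /rank_eq_colP/(_ x ux j)/eqP := ru.
  by rewrite (negPf xj).
exists k; first exact: mem_index_enum.
by rewrite /= lt_neqAle ge0 andbT eq_sym expf_neq0.
Qed.

End spanning.

Theorem theorem4p3 (R : realType) (n : nat) (alpha : R) (c : 'I_n -> R) :
  (2 <= n)%N -> 0 < alpha ->
  (forall j, 0 <= c j) ->
  (forall j : 'I_n, nat_of_ord j = 0%N -> c j = 0) ->
  positive_definite (hadamard_pow (pascal_tensor 2 c) alpha) ->
  forall m : nat, (2 <= m)%N ->
    strongly_completely_positive (hadamard_pow (pascal_tensor m c) alpha) /\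
    (~~ odd m -> positive_definite (hadamard_pow (pascal_tensor m c) alpha)).
Proof.
move=> n2 alpha0 c0 c1 pd2 m m2.
have m0 : (0 < m)%N by exact: leq_trans m2.
suff scp : strongly_completely_positive (hadamard_pow (pascal_tensor m c) alpha).
  by split=> // em; exact: positive_definite_of_spanning.
have [u [u0 Au]] := caratheodory m0 (completely_positive_pascal m0 c0 (ltW alpha0)).
have n0 : (0 < n)%N by exact: leq_trans n2.
exists _, u; split=> //; split=> //.
(* Writing the order as [m.+2] leaves [m] indices to freeze at the first one, where the generator is
   0. *)
case: m m2 m0 u u0 Au => [//|[//|m]] _ _ u u0 Au.
apply: (spanning_of_slice (o := Ordinal n0) Au _ pd2) => i.
by apply: pascal_pad_index; exact: c1.
Qed.
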